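(* Let $d\ge2$, let $\mathcal C\subseteq\mathcal X$ be nonempty, closed and convex with $\mathcal X^\star\neq\emptyset$, and let $\preccurlyeq$ be convex and plateau-free. Assume that $\preccurlyeq$ is $r_x$-regular at every $x\in\mathcal C\setminus\mathcal X^\star$, with regularity radius $r_x>0$. Let $x_1\in\mathcal C\setminus\mathcal X^\star$ and $D_1:=\operatorname{dist}(x_1,\mathcal X^\star)$. Run the NDD method from $x_1$ for $K\ge1$ iterations with stepsize $\eta=D_1/\sqrt K$, comparison radius $h>0$ and $T\ge1$ planar bisection steps. Then the method uses at most $K\big((d-1)(T+3)+2\big)$ pairwise comparisons. Moreover, let $$\widetilde D:=\min\left\{D_1+\frac\eta2(K-1),\ \operatorname{diam}(\mathcal C)\right\},\qquad \hat\epsilon:=\frac{2D_1}{\sqrt K}+\frac{\pi\sqrt{d-1}\,\widetilde D}{2^{T-1}} .$$ Then at least one of the following holds for the output $\hat x$: (i) $\Delta_{\mathrm{LS}}(\hat x)\le\hat\epsilon$; (ii) there exists $k\in\{1,\dots,K\}$ (with $x_k\notin\mathcal X^\star$) such that $$r_{x_k}<\frac{4\sqrt{d-1}\,\widetilde D\,h}{\hat\epsilon},$$ and in this case $\hat x\preccurlyeq x_k$.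
   Context: Setting. $(\mathcal X,\langle\cdot,\cdot\rangle)$ is a $d$-dimensional real Euclidean space with norm $\|\cdot\|$, unit sphere $\mathbb S^{d-1}$ and closed balls $B(z,r)$. $\preccurlyeq$ is a complete and transitive binary relation on $\mathcal X$ (''$x\preccurlyeq y$'': $x$ is no worse than $y$); $x\prec y$ means $x\preccurlyeq y$ and not $y\preccurlyeq x$; $x\sim y$ means $x\preccurlyeq y$ and $y\preccurlyeq x$. $\mathcal C$ is the feasible set and $\mathcal X^\star=\{x\in\mathcal C:x\preccurlyeq y\ \forall y\in\mathcal C\}$. $\mathcal S_x=\{y\in\mathcal X:y\preccurlyeq x\}$, $\mathcal L_x=\{y\in\mathcal X:y\sim x\}$. $\preccurlyeq$ is plateau-free if $\partial\mathcal S_x=\mathcal L_x$ for every $x\in\mathcal X\setminus\mathcal X^\star$; convex if $\mathcal S_x$ is convex for every $x\in\mathcal X$. $\operatorname{dist}$ is Euclidean distance (infimum), between points/sets; $\Pi_{\mathcal C}$ is Euclidean projection onto $\mathcal C$; $\operatorname{diam}(\mathcal C)\in[0,\infty]$. The level-set optimality gap is $\Delta_{\mathrm{LS}}(x)=\operatorname{dist}(\mathcal X^\star,\mathcal L_x)$. Regularity. For $x\in\partial\mathcal S_x$ and $r>0$, $\preccurlyeq$ is $r$-regular at $x$ if there is $n\in\mathbb S^{d-1}$ with $B(x-rn,r)\subseteq\mathcal S_x$ and $B(x+rn,r)\subseteq\overline{\mathcal X\setminus\mathcal S_x}$; then $n$ is unique, is denoted $n_x$, and the regularity radius is $r_x=\sup\{r\ge0:B(x-rn_x,r)\subseteq\mathcal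 S_x,\ B(x+rn_x,r)\subseteq\overline{\mathcal X\setminus\mathcal S_x}\}\in(0,\infty]$. A (pairwise) comparison of two points reveals which of $p\prec q$, $p\sim q$, $q\prec p$ holds. Subroutine $\mathrm{Planar}(x,h,a,b,T)$ ($a,b$ orthonormal). (1) Draw $\theta$ uniform on $[0,2\pi)$; set $\bar a=\cos\theta\,a+\sin\theta\,b$, $\bar b=-\sin\theta\,a+\cos\theta\,b$. (2) Compare $x$ with $x+h\bar a$ and with $x-h\bar a$. If ($x+h\bar a\preccurlyeq x$ and $x-h\bar a\preccurlyeq x$) or ($x\preccurlyeq x+h\bar a$ and $x\preccurlyeq x-h\bar a$), return $\bar a$. (3) If $x+h\bar a\preccurlyeq x$ set $(u_+,u_-)=(-\bar a,\bar a)$, else $(u_+,u_-)=(\bar a,-\bar a)$. (4) Compare $x$ with $x+h\bar b$; if $x+h\bar b\preccurlyeq x$ set $u_-=\bar b$, else $u_+=\bar b$. (5) For $t=1,\dots,T$: set $u_M=(u_++u_-)/\|u_++u_-\|$, compare $x$ with $x+hu_M$; if $x+hu_M\preccurlyeq x$ set $u_-=u_M$, else $u_+=u_M$. (6) Return the last computed $u_M$. Algorithm $\mathrm{NE}(x,h,T)$. Draw a Haar-uniform orthonormal basis $(q_1,\dots,q_d)$; set $v_1=q_1$. For $i=1,\dots,d-1$: let $y_i=\mathrm{Planar}(x,h,v_i,q_{i+1},T)$ and $v_{i+1}=-\langle y_i,q_{i+1}\rangle v_i+\langle y_i,v_i\rangle q_{i+1}$. Finally compare $x$ with $x+hv_d$;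 return $-v_d$ if $x+hv_d\prec x$, and $v_d$ otherwise. NDD method with parameters $(x_1,\eta,h,T,K)$. Set $\hat x=x_1$. For $k=1,\dots,K$: let $\widehat n_k=\mathrm{NE}(x_k,h,T)$ and $x_{k+1}=\Pi_{\mathcal C}(x_k-\eta\widehat n_k)$; if $x_{k+1}\prec\hat x$ set $\hat x=x_{k+1}$. Return $\hat x$. *)

(* Defs.v *)
From HB Require Import structures.
From mathcomp Require Import all_boot all_order all_algebra.
From mathcomp Require Import all_classical all_reals all_analysis.

Set Implicit Arguments.
Unset Strict Implicit.
Unset Printing Implicit Defensive.

Import Order.TTheory GRing.Theory Num.Theory.
Import numFieldNormedType.Exports.

Local Open Scope classical_set_scope.
Local Open Scope ring_scope.

Section Geometry.
Context {R : realType} {X : normedModType R}.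
Implicit Types (A B : set X) (x y z : X).

Definition boundary A : set X := closure A `\` interior A.

(* Real infimum: meaningful only for nonempty [A] and [B], since [inf set0 = 0]. *)
Definition set_dist A B : R := inf [set `|a - b| | a in A & b in B].

Definition diam A : \bar R :=
  ereal_sup [set (`|a - b|)%:E | a in A & b in A].

Definition proj_onto A z : X :=
  xget z [set p | A p /\ forall y, A y -> `|z - p| <= `|z - y|].

Definition orthonormal_family d (dot : X -> X -> R) (q : d.-tuple X) : Prop :=
  forall i j, (i < d)%N -> (j < d)%N -> dot q`_i q`_j = (i == j)%:R.

End Geometry.

(* [pref x y] reads "x is no worse than y". *)
Section Preference.
Context {R : realType} {X : normedModType R} (pref : rel X).
Implicit Types (C : set X) (x y n : X) (r : R).

Definition indifferent x y : bool := pref x y && pref y x.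

Definition optima C : set X := [set x | C x /\ forall y, C y -> pref x y].
Definition sublevel x : set X := [set y | pref y x].
Definition level x : set X := [set y | indifferent y x].

Definition plateau_free C : Prop :=
  forall x, ~ optima C x -> boundary (sublevel x) = level x.

Definition convex_pref : Prop :=
  forall x, convex_set (sublevel x : set (convex_lmodType X)).

Definition level_set_gap C x : R := set_dist (optima C) (level x).

(* [closed_ball_] is used instead of [closed_ball] because the latter is
   empty at radius 0. *)
Definition tangent_balls x n r : Prop :=
  closed_ball_ Num.norm (x - r *: n) r `<=` sublevel x /\
  closed_ball_ Num.norm (x + r *: n) r `<=` closure (~` sublevel x).

Definition regular_at r x : Prop :=
  [/\ boundary (sublevel x) x, 0 < r &
      exists2 n, `|n| = 1 & tangent_balls x n r].

(* The unit normal is unique wherever [pref] is regular; elsewhere the value is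
   irrelevant. *)
Definition normal_at x : X :=
  xget 0 [set n | `|n| = 1 /\ exists2 r, 0 < r & tangent_balls x n r].

Definition regularity_radius x : \bar R :=
  ereal_sup [set r%:E | r in [set r | 0 <= r /\ tangent_balls x (normal_at x) r]].

End Preference.

(* Comparison-based procedures are programs that can access the preference only
   by asking for the comparison of two points; [exec] answers the questions and
   counts them. *)
Variant answer := FirstBetter | Tie | SecondBetter.

Definition first_no_worse (c : answer) : bool :=
  if c is SecondBetter then false else true.
Definition second_no_worse (c : answer) : bool :=
  if c is FirstBetter then false else true.
Definition first_better (c : answer) : bool :=
  if c is FirstBetter then true else false.
Definition second_better (c : answer) : bool :=
  if c is SecondBetter then true else false.

Inductive prog (X A : Type) : Type :=
| Ret of A
| Compare of X & X & (answer -> prog X A).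
Arguments Ret {X A}.
Arguments Compare {X A}.

Fixpoint bind {X A B : Type} (m : prog X A) (f : A -> prog X B) : prog X B :=
  match m with
  | Ret a => f a
  | Compare p p' k => Compare p p' (fun c => bind (k c) f)
  end.

Definition ask {X : Type} (p p' : X) : prog X answer := Compare p p' Ret.

Notation "'let*' x := m 'in' f" := (bind m (fun x => f))
  (at level 200, x pattern, m at level 100, f at level 200).

Definition comparison_of {X : Type} (pref : rel X) (p p' : X) : answer :=
  if pref p p' then (if pref p' p then Tie else FirstBetter) else SecondBetter.

(* Result of the program together with the number of comparisons it made. *)
Fixpoint exec {X A : Type} (pref : rel X) (m : prog X A) : A * nat :=
  match m with
  | Ret a => (a, 0%N)
  | Compare p p' k =>
      let: (a, n) := exec pref (k (comparison_of pref p p')) in (a, n.+1)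
  end.

Section Algorithms.
Context {R : realType} {X : normedModType R} (dot : X -> X -> R).

(* [cur] is the last computed midpoint; its initial value is returned only
   when [T = 0]. *)
Fixpoint bisect (x : X) (h : R) (T : nat) (up um cur : X) : prog X X :=
  if T is T'.+1 then
    let uM := (`|up + um|)^-1 *: (up + um) in
    let* c := ask x (x + h *: uM) in
    if second_no_worse c then bisect x h T' up uM uM
    else bisect x h T' uM um uM
  else Ret cur.

(* [th] is the random angle drawn by the subroutine. *)
Definition planar (x : X) (h : R) (a b : X) (T : nat) (th : R) : prog X X :=
  let a' := cos th *: a + sin th *: b in
  let b' := - sin th *: a + cos th *: b in
  let* cp := ask x (x + h *: a') in
  let* cm := ask x (x - h *: a') in
  if second_no_worse cp && second_no_worse cm
     || first_no_worse cp && first_no_worse cm then Ret a'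
  else
    let: (up, um) := if second_no_worse cp then (- a', a') else (a', - a') in
    let* cb := ask x (x + h *: b') in
    let: (up, um) := if second_no_worse cb then (up, b') else (b', um) in
    bisect x h T up um um.

(* The vector v_(i+1). The drawn basis is indexed from 0, so q_(i+1) is [q`_i];
   [th i] is the angle drawn by the (i+1)-st call to [planar]. *)
Fixpoint ne_direction (x : X) (h : R) (T : nat) (q : seq X) (th : nat -> R)
    (i : nat) : prog X X :=
  if i is j.+1 then
    let* v := ne_direction x h T q th j in
    let* y := planar x h v q`_j.+1 T (th j) in
    Ret (- dot y q`_j.+1 *: v + dot y v *: q`_j.+1)
  else Ret q`_0.

Definition normal_estimate (d : nat) (x : X) (h : R) (T : nat)
    (q : d.-tuple X) (th : nat -> R) : prog X X :=
  let* v := ne_direction x h T q th d.-1 in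
  let* c := ask x (x + h *: v) in
  Ret (if second_better c then - v else v).

(* The pair (x_(k+1), current value of the output) after [k] iterations;
   [q k] and [th k] are the draws made by the (k+1)-st iteration. *)
Fixpoint ndd (d : nat) (C : set X) (x1 : X) (eta h : R) (T : nat)
    (q : nat -> d.-tuple X) (th : nat -> nat -> R) (k : nat) : prog X (X * X) :=
  if k is j.+1 then
    let* (x, xhat) := ndd C x1 eta h T q th j in
    let* n := normal_estimate x h T (q j) (th j) in
    let x' := proj_onto C (x - eta *: n) in
    let* c := ask x' xhat in
    Ret (x', if first_better c then x' else xhat)
  else Ret (x1, x1).

End Algorithms.

Section Sampling.
Context {R : realType} {X : normedModType R} (dot : X -> X -> R).
Context {disp : measure_display} {Omega : measurableType disp}.
Context (P : probability Omega R).

Lemma two_pi_gt0 : (0 : R) < 2 * pi.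
Proof. by rewrite mulr_gt0 // pi_gt0. Qed.

Definition uniform_angle (th : {RV P >-> R}) : Prop :=
  (forall w, 0 <= th w < 2 * pi) /\
  forall A : set (measurableTypeR R), measurable A ->
    P (th @^-1` A) = uniform_prob two_pi_gt0 A.

(* The Haar law is the only law on orthonormal bases that is invariant under
   the orthogonal group. Boxes of open sets form a pi-system generating the
   Borel sigma-algebra of X^d, so they determine laws on X^d. *)
Definition haar_basis (d : nat) (q : Omega -> d.-tuple X) : Prop :=
  [/\ forall w, orthonormal_family dot (q w),
      forall (U : set X) i, (i < d)%N -> open U ->
        measurable [set w | U (q w)`_i] &
      forall (g : {linear X -> X}) (U : nat -> set X),
        (forall x, `|g x| = `|x|) -> (forall i, open (U i)) ->
        P [set w | forall i, (i < d)%N -> U i (g (q w)`_i)] =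
        P [set w | forall i, (i < d)%N -> U i (q w)`_i]].

(* Draws of [K] iterations: one basis and [d - 1] angles per iteration, all of
   them mutually independent (taking some of the sets to be the full space
   gives the product rule for subfamilies). *)
Record ndd_draws (d K : nat) (q : nat -> Omega -> d.-tuple X)
    (th : nat -> nat -> {RV P >-> R}) : Prop := NddDraws {
  draws_basis : forall k, (k < K)%N -> haar_basis (q k);
  draws_angle : forall k i, (k < K)%N -> (i < d.-1)%N -> uniform_angle (th k i);
  draws_indep : forall (U : nat -> nat -> set X)
      (V : nat -> nat -> set (measurableTypeR R)),
    (forall k i, open (U k i)) -> (forall k i, measurable (V k i)) ->
    P [set w | forall k, (k < K)%N ->
        (forall i, (i < d)%N -> U k i (q k w)`_i) /\
        (forall i, (i < d.-1)%N -> V k i (th k i w))] =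
    (\prod_(k < K) (P [set w | forall i, (i < d)%N -> U k i (q k w)`_i] *
                    \prod_(i < d.-1) P (th k i @^-1` V k i)))%E }.

End Sampling.

(* Main.v *)
From HB Require Import structures.
Require Import Defs.
From mathcomp Require Import all_boot all_order all_algebra.
From mathcomp Require Import all_classical all_reals all_analysis.
From mathcomp Require Import ring lra zify.

(* The guarantee holds for every outcome of the random draws. If n is the unit
   normal at x and r its regularity radius, convexity puts the sublevel set of x
   in the half-space below the tangent hyperplane, so for a unit vector u the
   point x + h u is strictly worse than x when <n,u> > 0 and strictly better when
   <n,u> < -h/(2r). Planar bisection therefore ends with a unit vector y such that
   |<n,y>| <= h/(2r) + pi/2^(T+1). The d-1 vectors y found by NE, completed by the
   returned direction, form an orthonormal basis, and Parseval's identity bounds the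
   error of the estimated normal by sqrt(d-1) (pi/2^T + 2h/r).

   For an optimum a, the point a + <n,x-a> n lies on the tangent hyperplane at x,
   hence outside the interior of the sublevel set, and the segment from a to it
   crosses the level set of x: <n,x-a> is at least the gap of x. If the gap of
   the output exceeds the target and all radii are large, every step thus decreases
   |x_k - a|^2 by more than eta^2 = D1^2/K; this is impossible over K steps when a
   is close enough to realizing D1. The distances to a never increase, so that D1
   itself plays the role of the bound on them. *)

Set Implicit Arguments.
Unset Strict Implicit.
Unset Printing Implicit Defensive.

Import Order.TTheory GRing.Theory Num.Theory.
Import numFieldNormedType.Exports.

Local Open Scope classical_set_scope.
Local Open Scope ring_scope.

(** * Inner products *)

(** The left side is [4 * sin (x / 2) ^+ 2], a squared chord of the unit circle; the mean value
    theorem bounds the sine by its argument. *)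
Lemma chord_le_arc (R : realType) (x : R) : 0 <= x -> 2 - 2 * cos x <= x ^+ 2.
Proof.
move=> x0; have sinle (y : R) : 0 <= y -> `|sin y| <= y.
  move=> y0; have sd (z : R) : z \in `]0, y[%R -> is_derive z 1 (@sin R) (cos z).
    by move=> _; exact: is_derive_sin.
  have cs : {within `[0, y], continuous (@sin R)}.
    by apply: continuous_subspaceT; exact: continuous_sin.
  have [c _] := MVT_segment y0 sd cs.
  rewrite sin0 !subr0 => ->; rewrite normrM (ger0_norm y0).
  by rewrite ler_piMl ?cos_max.
have -> : cos x = 1 - 2 * sin (x / 2) ^+ 2.
  rewrite [x in LHS](_ : x = (x / 2) *+ 2); last by rewrite -mulr_natr; field.
  by rewrite cos_mulr2n cos2sin2 -mulr_natr; ring.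
have /sinle : 0 <= x / 2 by rewrite divr_ge0.
rewrite -ler_sqr ?nnegrE ?divr_ge0// real_normK ?num_real//.
by rewrite expr_div_n; lra.
Qed.

Record inner_product {R : realType} {X : normedModType R} (dot : X -> X -> R) : Prop :=
  InnerProduct {
    dotC : forall x y, dot x y = dot y x;
    dotDr : forall x y z, dot x (y + z) = dot x y + dot x z;
    dotZr : forall a x y, dot x (a *: y) = a * dot x y;
    sqr_norm : forall x, `|x| ^+ 2 = dot x x }.

Lemma inner_product_dot (R : realType) (X : normedModType R)
    (dot : {dot X for idfun}) :
  (forall x : X, `|x| = Num.sqrt (dot x x)) -> inner_product dot.
Proof.
move=> norm_dot; split=> [x y|x y z|a x y|x].
- by rewrite hermC expr0 mul1r.
- exact: linearDr.
- exact: linearZr_LR.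
- rewrite norm_dot sqr_sqrtr//; have [->|x0] := eqVneq x 0.
    by rewrite linear0l.
  exact/ltW/neq0_dnorm_gt0.
Qed.

Section DotProduct.
Context {R : realType} {X : normedModType R} (dot : X -> X -> R).
Context (ip : inner_product dot).
Implicit Types (x y z u v : X) (a b t : R).

Lemma dotDl x y z : dot (y + z) x = dot y x + dot z x.
Proof. by rewrite !(dotC ip _ x) (dotDr ip). Qed.

Lemma dotZl a x y : dot (a *: y) x = a * dot y x.
Proof. by rewrite !(dotC ip _ x) (dotZr ip). Qed.

Lemma dotNr x y : dot x (- y) = - dot x y.
Proof. by rewrite -scaleN1r (dotZr ip) mulN1r. Qed.

Lemma dotNl x y : dot (- y) x = - dot y x.
Proof. by rewrite !(dotC ip _ x) dotNr. Qed.

Lemma dot0l x : dot 0 x = 0.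
Proof. by rewrite -(scale0r x) dotZl mul0r. Qed.

Definition dotE := (dotDl, dotDr ip, dotNl, dotNr, dotZl, dotZr ip).

Lemma dot_suml (I : Type) (r : seq I) (F : I -> X) x :
  dot (\sum_(i <- r) F i) x = \sum_(i <- r) dot (F i) x.
Proof. by elim/big_rec2: _ => [|i a y _ <-]; rewrite ?dot0l ?dotDl. Qed.

Lemma dot_ge0 x : 0 <= dot x x.
Proof. by rewrite -(sqr_norm ip) sqr_ge0. Qed.

Lemma dot1_norm x : dot x x = 1 -> `|x| = 1.
Proof.
by move=> xx; apply/eqP; rewrite -(@pexpr_eq1 _ _ 2)// (sqr_norm ip) xx.
Qed.

Lemma norm1_dot x : `|x| = 1 -> dot x x = 1.
Proof. by rewrite -(sqr_norm ip) => ->; rewrite expr1n. Qed.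

(** Cauchy-Schwarz: with [p] and [q] the norms of [x] and [y], the squared norm of [q *: x - p *: y]
    is [2 * (p * q) * (p * q - dot x y)]. *)
Lemma dot_le x y : dot x y <= `|x| * `|y|.
Proof.
have [->|x0] := eqVneq x 0; first by rewrite dot0l normr0 mul0r.
have [->|y0] := eqVneq y 0; first by rewrite (dotC ip) dot0l normr0 mulr0.
have := dot_ge0 (`|y| *: x - `|x| *: y).
rewrite !dotE -!(sqr_norm ip) (dotC ip y x).
have : 0 < `|x| * `|y| by rewrite mulr_gt0 ?normr_gt0.
set p := `|x|; set q := `|y|; set c := dot x y => pq.
rewrite (_ : _ + _ = 2 * (p * q) * (p * q - c)); last ring.
by rewrite pmulr_rge0 ?subr_ge0// mulr_gt0.
Qed.

Lemma dot_ge x y : - (`|x| * `|y|) <= dot x y.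
Proof. by have := dot_le (- x) y; rewrite dotNl normrN lerNl. Qed.

Context (d : nat) (q : d.-tuple X).
Context (dimX : Vector.axiom d X) (orth_q : orthonormal_family dot q).

(** Orthonormal vectors are independent, so their coordinate matrix [M] is invertible and they span;
    pairing with each basis vector identifies the coefficients. *)
Lemma orthonormal_expansion x : x = \sum_(j < d) dot x q`_j *: q`_j.
Proof.
case: dimX => f lin_f bij_f.
pose g : {linear X -> 'rV[R]_d} := HB.pack f (GRing.isLinear.Build _ _ _ _ f lin_f).
pose M : 'M[R]_d := \matrix_i g q`_i.
have gE (c : 'rV[R]_d) : c *m M = g (\sum_(j < d) c 0 j *: q`_j).
  rewrite mulmx_sum_row linear_sum; apply: eq_bigr => j _.
  by rewrite linearZ rowK.
have coefE (c : 'rV[R]_d) (i : 'I_d) : dot (\sum_(j < d) c 0 j *: q`_j) q`_i = c 0 i.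
  rewrite dot_suml (bigD1 i)//= dotZl orth_q// eqxx mulr1 big1 ?addr0// => j ji.
  by rewrite dotZl orth_q// (_ : (j == i :> nat) = false) ?mulr0//; exact/negbTE.
have Mu : M \in unitmx.
  rewrite -row_free_unit; apply: inj_row_free => c.
  rewrite gE -(linear0 g) => /(bij_inj bij_f) c0.
  by apply/rowP => i; rewrite -[LHS]coefE c0 dot0l linear0 mxE.
have xE : x = \sum_(j < d) (g x *m invmx M) 0 j *: q`_j.
  by apply: (bij_inj bij_f); rewrite -[f]/(g : X -> _) -gE mulmxKV.
rewrite [LHS]xE; apply: eq_bigr => i _; congr (_ *: _).
by rewrite {2}xE coefE.
Qed.

Lemma parseval x : dot x x = \sum_(j < d) dot x q`_j ^+ 2.
Proof.
rewrite {1}(orthonormal_expansion x) dot_suml; apply: eq_bigr => j _.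
by rewrite dotZl (dotC ip q`_j) expr2.
Qed.

End DotProduct.

(** * Comparison programs *)

Section Execution.
Context {X : Type} (pref : rel X).

Lemma exec_bind A B (m : prog X A) (f : A -> prog X B) :
  exec pref (bind m f) =
  ((exec pref (f (exec pref m).1)).1,
   ((exec pref m).2 + (exec pref (f (exec pref m).1)).2)%N).
Proof.
elim: m => [a|p p' k IH] /=; first by case: exec.
by rewrite IH; case: (exec pref (k _)).
Qed.

Lemma exec_bind1 A B (m : prog X A) (f : A -> prog X B) :
  (exec pref (bind m f)).1 = (exec pref (f (exec pref m).1)).1.
Proof. by rewrite exec_bind. Qed.

Lemma exec_bind2 A B (m : prog X A) (f : A -> prog X B) :
  (exec pref (bind m f)).2 =
  ((exec pref m).2 + (exec pref (f (exec pref m).1)).2)%N.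
Proof. by rewrite exec_bind. Qed.

Lemma exec_ask p p' : exec pref (ask p p') = (comparison_of pref p p', 1%N).
Proof. by []. Qed.

Context (pref_total : total pref).

Lemma first_no_worseE p p' : first_no_worse (comparison_of pref p p') = pref p p'.
Proof. by rewrite /comparison_of; case: (pref p p'); case: (pref p' p). Qed.

(** Totality enters because [comparison_of] answers [SecondBetter] as soon as [pref p p'] fails. *)
Lemma second_no_worseE p p' : second_no_worse (comparison_of pref p p') = pref p' p.
Proof.
have := pref_total p p'; rewrite /comparison_of.
by case: (pref p p'); case: (pref p' p).
Qed.

Lemma first_betterE p p' : first_better (comparison_of pref p p') = ~~ pref p' p.
Proof.
have := pref_total p p'; rewrite /comparison_of.
by case: (pref p p'); case: (pref p' p).
Qed.

Lemma second_betterE p p' : second_better (comparison_of pref p p') = ~~ pref p p'.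
Proof. by rewrite /comparison_of; case: (pref p p'); case: (pref p' p). Qed.

End Execution.

(** * Number of comparisons *)

Section Counting.
Context {R : realType} {X : normedModType R} (dot : X -> X -> R) (pref : rel X).
Implicit Types (x a b : X) (h t : R) (C : set X).

Lemma bisect_count x h T up um cur :
  (exec pref (bisect x h T up um cur)).2 = T.
Proof.
elim: T up um cur => [//|T IH] up um cur.
by rewrite [bisect _ _ _.+1 _ _ _]/bisect -/bisect exec_bind2; case: ifP; rewrite IH.
Qed.

(** Three comparisons fix the starting pair and each bisection step costs one; an early exit stops
    after two. *)
Lemma planar_count x h a b T t :
  ((exec pref (planar x h a b T t)).2 <= T + 3)%N.
Proof.
rewrite /planar !exec_bind2 !exec_ask /=; case: ifP => [_|_] /=.
  by rewrite !addnS.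
case: ifP => _ /=; case: ifP => _;
  match goal with |- context [bisect ?y ?h ?T ?u ?v ?w] =>
    have := bisect_count y h T u v w end;
  by case: exec => ? ? /= ->; lia.
Qed.

Lemma ne_direction_count x h T (q : seq X) th i :
  ((exec pref (ne_direction dot x h T q th i)).2 <= i * (T + 3))%N.
Proof.
elim: i => [//|i IH]; rewrite /ne_direction -/ne_direction.
rewrite exec_bind2 [X in (_ + X)%N]exec_bind2.
by rewrite [(exec _ (Ret _)).2]/= addn0 mulSn [leqRHS]addnC leq_add// planar_count.
Qed.

Lemma normal_estimate_count d x h T (q : d.-tuple X) th :
  ((exec pref (normal_estimate dot x h T q th)).2 <= (d - 1) * (T + 3) + 1)%N.
Proof.
rewrite /normal_estimate exec_bind2 [X in (_ + X)%N]exec_bind2 exec_ask.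
rewrite [(exec _ (Ret _)).2]/= subn1.
by rewrite leq_add// ne_direction_count.
Qed.

Lemma exec_ndd_succ d C x1 eta h T (q : nat -> d.-tuple X) th k :
  exec pref (ndd dot C x1 eta h T q th k.+1) =
  let s := exec pref (ndd dot C x1 eta h T q th k) in
  let n := exec pref (normal_estimate dot s.1.1 h T (q k) (th k)) in
  let x' := proj_onto C (s.1.1 - eta *: n.1) in
  ((x', if first_better (comparison_of pref x' s.1.2) then x' else s.1.2),
   (s.2 + (n.2 + 1))%N).
Proof.
rewrite [ndd _ _ _ _ _ _ _ _ k.+1]/ndd -/(ndd _ _ _ _ _ _ _ _ _) exec_bind.
by case: (exec pref (ndd _ _ _ _ _ _ _ _ _)) => -[x xh] m; rewrite exec_bind.
Qed.

Lemma ndd_count d C x1 eta h T (q : nat -> d.-tuple X) th k :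
  ((exec pref (ndd dot C x1 eta h T q th k)).2
     <= k * ((d - 1) * (T + 3) + 2))%N.
Proof.
elim: k => [//|k IH]; rewrite exec_ndd_succ; cbv zeta; rewrite [X in (X <= _)%N]/=.
set s := exec pref (ndd _ _ _ _ _ _ _ _ _).
have := normal_estimate_count s.1.1 h T (q k) (th k).
by rewrite -/s in IH; lia.
Qed.
End Counting.

(** * Accuracy of the normal estimate *)

(* When [c < 0] the sign of the estimate is wrong, but then [c] is small, so that
   [m * B ^+ 2] is already close to 1. *)
Lemma sphere_error_bound (R : realFieldType) (B m tau c : R) :
  0 <= tau -> tau <= B -> 1 <= m -> c <= 1 -> - tau <= c ->
  1 <= c ^+ 2 + m * B ^+ 2 -> 2 - 2 * c <= m * (2 * B + 2 * tau) ^+ 2.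
Proof.
move=> tau0 tB m1 c1 ctau cB.
have B0 : 0 <= B := le_trans tau0 tB.
have m0 : 0 <= m := le_trans ler01 m1.
have mBt : tau ^+ 2 <= m * (B * tau).
  rewrite expr2 -[leLHS]mul1r ler_pM ?mulr_ge0//.
  by rewrite ler_wpM2r.
have mt : tau ^+ 2 <= m * tau ^+ 2 by rewrite -[leLHS]mul1r ler_wpM2r ?sqr_ge0.
have -> : m * (2 * B + 2 * tau) ^+ 2 =
    4 * (m * B ^+ 2) + 8 * (m * (B * tau)) + 4 * (m * tau ^+ 2) by ring.
have t2 := sqr_ge0 tau.
have [c0|c0] := leP 0 c.
  have cc : c ^+ 2 <= c by rewrite expr2 ler_piMl.
  lra.
have cc : c ^+ 2 <= tau ^+ 2.
  by rewrite -sqrrN ler_sqr ?nnegrE ?oppr_ge0 ?(ltW c0)// lerNl.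
(* What remains is [2 + 2 * tau <= 4 + 8 * tau ^+ 2], which this square implies. *)
have := sqr_ge0 (4 * tau - 1); rewrite sqrrB1 exprMn; lra.
Qed.

Section NormalEstimation.
Context {R : realType} {X : normedModType R} (dot : X -> X -> R).
Context (ip : inner_product dot).
Implicit Types (a b u v y : X) (phi t : R).

(** By the half-angle formula [u + v] has norm [2 * cos (phi / 2)]; the bound on [phi] keeps this
    divisor positive. *)
Lemma midpoint_dot u v phi :
  0 <= phi <= pi / 2 -> dot u u = 1 -> dot v v = 1 -> dot u v = cos phi ->
  let m := (`|u + v|)^-1 *: (u + v) in
  [/\ dot m m = 1, dot u m = cos (phi / 2) & dot v m = cos (phi / 2)].
Proof.
move=> /andP[phi0 phi1] uu vv uv m.
have pi0 := pi_gt0 R.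
have c0 : 0 < cos (phi / 2).
  by apply: cos_gt0_pihalf; apply/andP; split; lra.
have cE : cos phi = 2 * cos (phi / 2) ^+ 2 - 1.
  rewrite [phi in LHS](_ : phi = (phi / 2) *+ 2); last by rewrite -mulr_natr; field.
  by rewrite cos_mulr2n -mulr_natr; ring.
have dE : dot (u + v) (u + v) = (2 * cos (phi / 2)) ^+ 2.
  by rewrite !(dotE ip) (dotC ip v u) uu vv uv cE; ring.
have nE : `|u + v| = 2 * cos (phi / 2).
  by apply/eqP; rewrite -(@eqrXn2 _ 2)// ?(sqr_norm ip) ?dE// mulr_ge0// ltW.
have cn0 : cos (phi / 2) != 0 by rewrite gt_eqF.
split.
- by rewrite /m (dotZl ip) (dotZr ip) dE nE; field.
- by rewrite /m (dotZr ip) (dotDr ip) uu uv nE cE; field.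
- by rewrite /m (dotZr ip) (dotDr ip) vv (dotC ip) uv nE cE; field.
Qed.

Definition in_span2 a b y := exists s t : R, y = s *: a + t *: b.

Lemma in_span2Z a b y t : in_span2 a b y -> in_span2 a b (t *: y).
Proof.
by move=> [r [s ->]]; exists (t * r), (t * s); rewrite scalerDr !scalerA.
Qed.

Lemma in_span2D a b u v : in_span2 a b u -> in_span2 a b v -> in_span2 a b (u + v).
Proof.
move=> [r [s ->]] [r' [s' ->]]; exists (r + r'), (s + s').
by rewrite !scalerDl addrACA.
Qed.

(* What regularity of the preference at [x] says about comparisons of [x] with
   points at distance [h]; for radius [r] one may take [tau = h / (2 r)]. *)
Context (pref : rel X) (x n : X) (h tau : R).
Context (pref_total : total pref) (n1 : dot n n = 1) (tau0 : 0 <= tau).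
Context (worse_above : forall u, dot u u = 1 -> 0 < dot n u ->
  ~~ pref (x + h *: u) x).
Context (better_below : forall u, dot u u = 1 -> dot n u < - tau ->
  ~~ pref x (x + h *: u)).

Let le0 u : dot u u = 1 -> pref (x + h *: u) x -> dot n u <= 0.
Proof. by move=> u1 p; rewrite leNgt; apply/negP => /(worse_above u1); rewrite p. Qed.

Let geN u : dot u u = 1 -> pref x (x + h *: u) -> - tau <= dot n u.
Proof. by move=> u1 p; rewrite leNgt; apply/negP => /(better_below u1); rewrite p. Qed.

Lemma exec_bisect_succ T up um cur :
  (exec pref (bisect x h T.+1 up um cur)).1 =
  let uM := (`|up + um|)^-1 *: (up + um) in
  (exec pref (if pref (x + h *: uM) x then bisect x h T up uM uM
              else bisect x h T uM um uM)).1.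
Proof.
by rewrite /bisect -/bisect exec_bind1 exec_ask second_no_worseE.
Qed.

(** Every step preserves the sign conditions on [up] and [um] and halves their angle. The midpoint
    is within [phi / 2] of both, so one endpoint bounds its component along [n] from below and the
    other from above. *)
Lemma bisect_accuracy a b T phi up um cur :
  0 <= phi <= pi / 2 -> dot up up = 1 -> dot um um = 1 -> dot up um = cos phi ->
  - tau <= dot n up -> dot n um <= 0 -> in_span2 a b up -> in_span2 a b um ->
  let y := (exec pref (bisect x h T.+1 up um cur)).1 in
  [/\ dot y y = 1, in_span2 a b y & `|dot n y| <= tau + phi / 2 ^+ T.+1].
Proof.
elim: T phi up um cur => [|T IH] phi up um cur phiI pp mm pm np nm ap am;
  rewrite exec_bisect_succ; cbv zeta;
  have [yy yp ym] := midpoint_dot phiI pp mm pm;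
  set y := _ *: _ in yy yp ym *;
  have ay : in_span2 a b y by exact/in_span2Z/in_span2D.
  clearbody y; suff : `|dot n y| <= tau + phi / 2 ^+ 1 by case: ifP.
  have near u : dot u u = 1 -> dot u y = cos (phi / 2) ->
      `|dot n y - dot n u| <= phi / 2.
    move=> uu uy; have p0 : 0 <= phi / 2 by case/andP: phiI => ? _; rewrite divr_ge0.
    have yu : `|y - u| <= phi / 2.
      rewrite -ler_sqr ?nnegrE// (sqr_norm ip) !(dotE ip) (dotC ip y u) yy uu uy.
      by have := chord_le_arc p0; lra.
    rewrite -(dotNr ip) -(dotDr ip) ler_norml.
    have := dot_le ip n (y - u); have := dot_ge ip n (y - u).
    by rewrite (dot1_norm ip n1) mul1r; move=> ? ?; apply/andP; split; lra.
  move: (near _ pp yp) (near _ mm ym).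
  rewrite expr1 !ler_norml => /andP[? ?] /andP[? ?].
  by move: tau0 => ?; apply/andP; split; lra.
clearbody y; have half : 0 <= phi / 2 <= pi / 2.
  by case/andP: phiI => ? ?; apply/andP; split; lra.
rewrite exprS invfM mulrA.
case: ifP => p; apply: IH => //; first exact: le0.
- by rewrite (dotC ip).
- by apply: geN => //; have := pref_total x (x + h *: y); rewrite p orbF.
Qed.

(** If the two opposite trials agree, the component of [n] along [a'] is already at most [tau] in
    absolute value. Otherwise [b'] replaces one of [a'] and [- a'], and bisection starts from a
    right angle. *)
Lemma planar_accuracy a b T t :
  dot a a = 1 -> dot b b = 1 -> dot a b = 0 ->
  let y := (exec pref (planar x h a b T.+1 t)).1 in
  exists c s, [/\ y = c *: a + s *: b, c ^+ 2 + s ^+ 2 = 1 &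
    `|dot n y| <= tau + pi / 2 ^+ T.+2].
Proof.
move=> aa bb ab; set y := (exec _ _).1.
have pi0 := pi_gt0 R.
suff [yy [c [s yE]] ny] : [/\ dot y y = 1, in_span2 a b y &
    `|dot n y| <= tau + pi / 2 ^+ T.+2].
  exists c, s; split => //; move: yy; rewrite yE !(dotE ip) (dotC ip b a) aa bb ab => <-.
  by ring.
pose a' := cos t *: a + sin t *: b; pose b' := - sin t *: a + cos t *: b.
have cs := cos2Dsin2 t.
have aa' : dot a' a' = 1.
  by rewrite /a' !(dotE ip) (dotC ip b a) aa bb ab -[RHS]cs; ring.
have bb' : dot b' b' = 1.
  by rewrite /b' !(dotE ip) (dotC ip b a) aa bb ab -[RHS]cs; ring.
have ab' : dot a' b' = 0 by rewrite /a' /b' !(dotE ip) (dotC ip b a) aa bb ab; ring.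
have sa' : in_span2 a b a' by exists (cos t), (sin t).
have sb' : in_span2 a b b' by exists (- sin t), (cos t).
have saN : in_span2 a b (- a') by rewrite -scaleN1r; exact: in_span2Z.
have aaN : dot (- a') (- a') = 1 by rewrite (dotNl ip) (dotNr ip) opprK.
have orth u : dot u b' = 0 -> dot b' u = 0 by rewrite (dotC ip b').
have abN : dot (- a') b' = 0 by rewrite (dotNl ip) ab' oppr0.
have xN : x - h *: a' = x + h *: (- a') by rewrite scalerN.
have tot u : pref (x + h *: u) x = false -> pref x (x + h *: u).
  by move=> p; have := pref_total x (x + h *: u); rewrite p orbF.
have fin up um cur : dot up up = 1 -> dot um um = 1 -> dot up um = 0 ->
    - tau <= dot n up -> dot n um <= 0 -> in_span2 a b up -> in_span2 a b um ->
    let z := (exec pref (bisect x h T.+1 up um cur)).1 in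
    [/\ dot z z = 1, in_span2 a b z & `|dot n z| <= tau + pi / 2 ^+ T.+2].
  move=> *; rewrite [in X in tau + X]exprS invfM mulrA.
  apply: bisect_accuracy => //; last by rewrite cos_pihalf.
  by apply/andP; split; lra.
rewrite /y /planar -/a' -/b' !exec_bind1 !exec_ask.
rewrite !second_no_worseE// !first_no_worseE// xN.
have naN : dot n (- a') = - dot n a' by rewrite (dotNr ip).
have pi2 : 0 <= pi / 2 ^+ T.+2 :> R by rewrite divr_ge0// ?exprn_ge0// ltW.
case: ifP => [/orP[] /andP[p1 p2]|/negbT].
- split=> //=; move: (le0 aa' p1) (le0 aaN p2); rewrite naN.
  move: pi2 tau0; generalize (pi / 2 ^+ T.+2 : R) => w ? ? ? ?.
  by rewrite ler_norml; apply/andP; split; lra.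
- split=> //=; move: (geN aa' p1) (geN aaN p2); rewrite naN.
  move: pi2 tau0; generalize (pi / 2 ^+ T.+2 : R) => w ? ? ? ?.
  by rewrite ler_norml; apply/andP; split; lra.
rewrite negb_or !negb_and => /andP[].
(* No early exit was taken, so the trials at [a'] and [- a'] disagree, which gives the sign
   conditions at both candidate endpoints. *)
case: ifP => p1 q1 q2; rewrite /= in q1 q2; cbv beta iota;
  rewrite exec_bind1 exec_ask second_no_worseE//.
  move/negbTE/tot in q1.
  case: ifP => p3; apply: fin => //.
  - exact: geN.
  - exact: le0.
  - exact: orth.
  - by apply: geN => //; exact: tot.
  - exact: le0.
have {}p1 := tot _ p1; rewrite p1 /= in q2.
have {q2}p2 : pref (x + h *: - a') x.
  by have := pref_total x (x + h *: - a'); rewrite (negbTE q2).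
case: ifP => p3; apply: fin => //.
- exact: geN.
- exact: le0.
- by rewrite (dotC ip).
- by apply: geN => //; exact: tot.
- exact: le0.
Qed.

(** In the plane of [v] and the next basis vector, [y] and the new direction form another
    orthonormal basis, so the two squared components of [n] keep their sum. Each step loses only the
    small component along [y]. *)
Lemma ne_direction_accuracy T d (q : d.-tuple X) th i :
  orthonormal_family dot q -> (i < d)%N ->
  let v := (exec pref (ne_direction dot x h T.+1 q th i)).1 in
  [/\ dot v v = 1, forall j, (i < j < d)%N -> dot v q`_j = 0 &
      \sum_(j < i.+1) dot n q`_j ^+ 2
        <= dot n v ^+ 2 + i%:R * (tau + pi / 2 ^+ T.+2) ^+ 2].
Proof.
move=> orth_q; elim: i => [|i IH] id.
  split=> /=; first by rewrite orth_q ?eqxx.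
    by move=> j /andP[j0 jd]; rewrite orth_q// (ltn_eqF j0).
  by rewrite big_ord1 mul0r addr0.
have {IH} [] := IH (ltnW id).
rewrite /ne_direction -/(ne_direction _ _ _ _ _ _ i) exec_bind1 exec_bind1.
set v := (exec pref (ne_direction _ _ _ _ _ _ i)).1.
move=> vv vq nv; have vb : dot v q`_i.+1 = 0 by apply: vq; rewrite ltnSn.
have bb : dot q`_i.+1 q`_i.+1 = 1 by rewrite orth_q// eqxx.
have [c [s []]] := planar_accuracy T (th i) vv bb vb.
set y := (exec _ (planar _ _ _ _ _ _)).1; set b := q`_i.+1 in vb bb *.
move=> yE cs ny; rewrite [(exec _ (Ret _)).1]/=.
have -> : dot y b = s by rewrite yE !(dotE ip) vb bb; ring.
have -> : dot y v = c by rewrite yE !(dotE ip) (dotC ip b v) vb vv; ring.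
split.
- by rewrite !(dotE ip) (dotC ip b v) vv bb vb -[RHS]cs; ring.
- move=> j /andP[ij jd].
  by rewrite !(dotE ip) vq ?jd ?(ltnW ij)// orth_q// (ltn_eqF ij) mulr0n; ring.
have -> : \sum_(j < i.+2) dot n q`_j ^+ 2 = \sum_(j < i.+1) dot n q`_j ^+ 2 + dot n b ^+ 2.
  by rewrite big_ord_recr.
have rot : dot n (- s *: v + c *: b) ^+ 2 + dot n y ^+ 2 = dot n v ^+ 2 + dot n b ^+ 2.
  by rewrite yE !(dotE ip) -[RHS]mul1r -[in RHS]cs; ring.
have : dot n y ^+ 2 <= (tau + pi / 2 ^+ T.+2) ^+ 2.
  rewrite -real_normK ?num_real// ler_sqr ?nnegrE//.
  by rewrite addr_ge0// divr_ge0 ?exprn_ge0 ?pi_ge0.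
move: nv rot; rewrite -(natr1 i) [(i%:R + 1) * _]mulrDl mul1r; lra.
Qed.

(** By Parseval, the accumulated bound at [d.-1] bounds [dot n v ^+ 2] from below. The last
    comparison picks the sign, up to an error [tau]. *)
Lemma normal_estimate_accuracy T d (q : d.-tuple X) th :
  Vector.axiom d X -> orthonormal_family dot q -> (2 <= d)%N ->
  let nh := (exec pref (normal_estimate dot x h T.+1 q th)).1 in
  dot nh nh = 1 /\ `|nh - n| <= Num.sqrt (d - 1)%:R * (pi / 2 ^+ T.+1 + 4 * tau).
Proof.
move=> dimX orth_q d2; rewrite /normal_estimate exec_bind1 exec_bind1.
have := @ne_direction_accuracy T _ _ th d.-1 orth_q.
rewrite prednK ?(ltn_trans _ d2)// leqnn => /(_ isT).
set v := (exec pref (ne_direction _ _ _ _ _ _ _)).1 => -[vv _].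
rewrite -(parseval ip dimX orth_q) n1 -subn1.
set B := tau + _; set m : R := (d - 1)%:R => nv.
have m1 : 1 <= m by rewrite ler1n subn_gt0.
rewrite exec_ask second_betterE [(exec _ (Ret _)).1]/=.
set nh : X := if _ then _ else _.
have [nhnh nhB nhtau] : [/\ dot nh nh = 1, 1 <= dot n nh ^+ 2 + m * B ^+ 2 &
    - tau <= dot n nh].
  rewrite /nh; case: ifPn => [p|/negPn p]; last by split=> //; exact: geN.
  have := pref_total x (x + h *: v); rewrite (negbTE p) => /(le0 vv) nv0.
  rewrite (dotNr ip) (dotNl ip) (dotNr ip) opprK sqrrN; split=> //.
  by rewrite lerN2 (le_trans nv0).
split=> //; have nh1 : dot n nh <= 1.
  by have := dot_le ip n nh; rewrite !(dot1_norm ip) ?mulr1.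
have Btau : tau <= B by rewrite lerDl divr_ge0 ?exprn_ge0 ?pi_ge0.
have B0 : 0 <= B := le_trans tau0 Btau.
have -> : pi / 2 ^+ T.+1 + 4 * tau = 2 * B + 2 * tau.
  by rewrite /B [2 ^+ T.+2]exprS invfM; field; rewrite expf_neq0.
have m0 : 0 <= m := le_trans ler01 m1.
have r0 : 0 <= 2 * B + 2 * tau by rewrite addr_ge0// mulr_ge0.
rewrite -ler_sqr ?nnegrE ?mulr_ge0 ?sqrtr_ge0// exprMn sqr_sqrtr// (sqr_norm ip).
have -> : dot (nh - n) (nh - n) = 2 - 2 * dot n nh.
  by rewrite !(dotE ip) (dotC ip nh n) nhnh n1; ring.
exact: sphere_error_bound.
Qed.

End NormalEstimation.

(** * Boundaries, supporting half-spaces and projections *)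

Section NormTopology.
Context {R : realType} {X : normedModType R}.
Implicit Types (A B : set X) (a b x y : X) (t e : R).

Lemma interior_normP A x :
  interior A x <-> exists2 e, 0 < e & forall y, `|x - y| < e -> A y.
Proof. exact: nbhs_normP. Qed.

Lemma closure_normP A x :
  closure A x <-> forall e, 0 < e -> exists2 y, A y & `|x - y| < e.
Proof.
split=> [cl e e0|cl B /nbhs_normP[e /= e0 eB]].
  have /cl[y [Ay yB]] : nbhs x [set y | `|x - y| < e] by apply/nbhs_normP; exists e.
  by exists y.
by have [y Ay xy] := cl e e0; exists y; split=> //; exact: eB.
Qed.

(** The supremum of the parameters whose points lie in [A] yields the boundary point. *)
Lemma segment_boundary A a b : A a -> ~ interior A b ->
  exists2 t, 0 <= t <= 1 & boundary A (a + t *: (b - a)).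
Proof.
move=> Aa nAb; pose g t := a + t *: (b - a).
have gB s t : `|g s - g t| = `|s - t| * `|b - a|.
  by rewrite /g opprD addrACA subrr add0r -scalerBl normrZ.
have near_g s e : 0 < e ->
    exists2 dl, 0 < dl & forall t, `|s - t| < dl -> `|g s - g t| < e.
  move=> e0; have b0 : 0 < `|b - a| + 1 by rewrite ltr_wpDl.
  exists (e / (`|b - a| + 1)); first by rewrite divr_gt0.
  move=> t; rewrite ltr_pdivlMr// gB; apply: le_lt_trans.
  by rewrite ler_wpM2l// lerDl.
pose E := [set t | 0 <= t <= 1 /\ A (g t)].
have E0 : E 0 by split; rewrite ?lexx ?ler01// /g scale0r addr0.
have E1 : ubound E 1 by move=> t [/andP[]].
have supE : has_sup E by split; [exists 0 | exists 1].
have s0 : 0 <= sup E by apply: ub_le_sup => //; exists 1.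
have s1 : sup E <= 1 by apply: ge_sup => //; exists 0.
exists (sup E); first by rewrite s0.
split.
  apply/closure_normP => e e0; have [dl dl0 dlE] := near_g (sup E) e e0.
  have [t Et ts] := sup_adherent dl0 supE.
  exists (g t); first by case: Et.
  apply: dlE; rewrite ger0_norm; first by rewrite ltrBlDl -ltrBlDr.
  by rewrite subr_ge0; apply: ub_le_sup => //; exists 1.
move=> /interior_normP[e e0 eA]; have [dl dl0 dlE] := near_g (sup E) e e0.
(* At [sup E = 1] the point is [b], not interior by assumption; below 1, interiority would put a
   larger parameter in [E]. *)
have [/eqP s1'|s_neq1] := boolP (sup E == 1).
  apply: nAb; apply/interior_normP; exists e => // y by_; apply: eA.
  by rewrite s1' scale1r subrKC.
have s_lt1 : sup E < 1 by rewrite lt_neqAle s_neq1.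
pose t := Num.min 1 (sup E + dl / 2).
have st : sup E < t by rewrite lt_min s_lt1 ltrDl divr_gt0.
suff /(ub_le_sup (ex_intro _ _ E1)) : E t by rewrite leNgt st.
split; first by rewrite (le_trans s0 (ltW st)) ge_min lexx.
apply: eA; apply: dlE; rewrite ltr0_norm ?subr_lt0// opprB ltrBlDl.
by rewrite gt_min ltrD2l ltr_pdivrMr// ltr_pMr// ltr1n orbT.
Qed.

Lemma convex_set_segment A a b t :
  convex_set (A : set (convex_lmodType X)) -> A a -> A b -> 0 <= t -> t <= 1 ->
  A (a + t *: (b - a)).
Proof.
move=> cA Aa Ab t0 t1.
have := cA b a (Itv01 t0 t1) (mem_set Ab) (mem_set Aa); rewrite inE.
rewrite /conv /=.
rewrite (_ : t *: b + _ = a + t *: (b - a))//.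
by rewrite scalerBl scale1r scalerBr addrCA.
Qed.

Lemma set_dist_le A B a b : A a -> B b -> set_dist A B <= `|a - b|.
Proof.
move=> Aa Bb; apply: ge_inf; first by exists 0 => _ [x _ [y _ <-]].
by exists a => //; exists b.
Qed.

Lemma set_dist_ge A B e : A !=set0 -> B !=set0 ->
  (forall a b, A a -> B b -> e <= `|a - b|) -> e <= set_dist A B.
Proof.
move=> [a Aa] [b Bb] eAB; apply: lb_le_inf.
  by exists `|a - b|; exists a => //; exists b.
by move=> _ [x Ax [y By <-]]; exact: eAB.
Qed.

Lemma set_dist_adherent A B e : A !=set0 -> B !=set0 -> 0 < e ->
  exists a b, [/\ A a, B b & `|a - b| < set_dist A B + e].
Proof.
move=> [a Aa] [b Bb] e0.
have infAB : has_inf [set `|a - b| | a in A & b in B].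
  split; first by exists `|a - b|; exists a => //; exists b.
  by exists 0 => _ [x _ [y _ <-]].
by have [_ [x Ax [y By <-]] xy] := inf_adherent e0 infAB; exists x, y.
Qed.

End NormTopology.

Section ConvexGeometry.
Context {R : realType} {X : normedModType R} (dot : X -> X -> R).
Context (ip : inner_product dot).
Implicit Types (S : set X) (x y z n p : X) (r t e : R).

(* If [y] in [S] were strictly above the tangent hyperplane at [x], the ray from
   [y] through [x] would enter the interior of the ball, putting [x] in the
   interior of [S]. *)
Lemma supporting_halfspace S x n r y :
  convex_set (S : set (convex_lmodType X)) -> boundary S x ->
  0 < r -> `|n| = 1 -> closed_ball_ Num.norm (x - r *: n) r `<=` S ->
  S y -> dot n (y - x) <= 0.
Proof.
move=> cS [_ nint] r0 n1 ballS Sy; rewrite leNgt; apply/negP => c0; apply: nint.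
have [w wE] : exists w, w = y - x by exists (y - x).
rewrite -wE in c0; set c := dot n w in c0.
have w0 : 0 < `|w| ^+ 2.
  rewrite exprn_gt0// normr_gt0; apply/eqP => w0.
  by move: c0; rewrite /c w0 (dotC ip) (dot0l ip) ltxx.
(* This [t] minimizes the distance from [x - t *: w] to the center of the ball and brings it below
   [r]. *)
pose t := r * c / `|w| ^+ 2.
have t0 : 0 < t by rewrite divr_gt0// mulr_gt0.
have rt : `|r *: n - t *: w| < r.
  rewrite -ltr_sqr ?nnegrE ?(ltW r0)// (sqr_norm ip) !(dotE ip) (dotC ip w n) -/c.
  rewrite (norm1_dot ip n1) -(sqr_norm ip).
  rewrite (_ : _ + _ = r ^+ 2 - (r * c) ^+ 2 / `|w| ^+ 2).
    by rewrite ltrBlDr ltrDl divr_gt0// exprn_gt0// mulr_gt0.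
  by rewrite /t; field; apply/eqP => wz; move: w0; rewrite wz expr0n ltxx.
set e := r - `|r *: n - t *: w|; have e0 : 0 < e by rewrite subr_gt0.
have s0 : 0 < 1 + t by rewrite addr_gt0.
have sn0 : 1 + t != 0 by rewrite gt_eqF.
apply/interior_normP; exists (e / (1 + t)); first by rewrite divr_gt0.
move=> p; rewrite ltr_pdivlMr// => xp.
(* The solution of [(1 + t) *: p = z + t *: y], so that [p] lies between [z] and [y]. *)
pose z := x - t *: w + (1 + t) *: (p - x).
have Sz : S z.
  apply: ballS; change (`|x - r *: n - z| <= r).
  have -> : x - r *: n - z = (t *: w - r *: n) + (1 + t) *: (x - p).
    rewrite /z opprD addrA; congr (_ + _); last by rewrite -scalerN opprB.
    by rewrite opprB addrC addrA subrK.
  apply: (le_trans (ler_normD _ _)).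
  rewrite normrZ (gtr0_norm s0) [X in X + _]distrC mulrC.
  by rewrite addrC -lerBrDr ltW.
have -> : p = z + (t / (1 + t)) *: (y - z).
  have -> : y - z = (1 + t) *: (w - (p - x)).
    rewrite scalerBr /z opprD addrA; congr (_ + _).
    by rewrite scalerDl scale1r opprB wE addrA addrAC.
  by rewrite scalerA divfK// scalerBr /z scalerDl scale1r addrACA subrK addrK subrKC.
apply: convex_set_segment => //; first by rewrite divr_ge0 ?(ltW t0) ?(ltW s0).
by rewrite ler_pdivrMr// mul1r lerDr.
Qed.

Context (d : nat) (q : d.-tuple X).
Context (dimX : Vector.axiom d X) (orth_q : orthonormal_family dot q).

(** Coordinates in the orthonormal basis transport the problem to row vectors, where the candidates
    no farther from [z] than [p0] form a closed subset of a box, hence a compact set. *)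
Lemma nearest_point_exists (C : set X) z : closed C -> C !=set0 ->
  exists p, C p /\ forall y, C y -> `|z - p| <= `|z - y|.
Proof.
move=> closedC [p0 Cp0].
pose f (v : 'rV[R]_d) : X := \sum_(j < d) v 0 j *: q`_j.
have cf : continuous f.
  rewrite /f; elim: (index_enum _) => [|j s IH] v.
    have -> : (fun u : 'rV[R]_d => \sum_(i <- [::]) u 0 i *: q`_i) = cst 0.
      by apply/funext => u; rewrite big_nil.
    exact: cst_continuous.
  have -> : (fun u : 'rV[R]_d => \sum_(i <- j :: s) u 0 i *: q`_i) =
      (fun u : 'rV[R]_d => u 0 j *: q`_j) \+ (fun u => \sum_(i <- s) u 0 i *: q`_i).
    by apply/funext => u; rewrite big_cons.
  apply: continuousD; last exact: IH.
  by apply: continuousZr_tmp; exact: coord_continuous.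
have fK (x : X) : exists v, f v = x.
  exists (\row_j dot x q`_j); rewrite [RHS](orthonormal_expansion ip dimX orth_q).
  by apply: eq_bigr => j _; rewrite mxE.
have fcoord (v : 'rV[R]_d) (i : 'I_d) : `|v 0 i| <= `|f v|.
  have -> : v 0 i = dot (f v) q`_i.
    rewrite (dot_suml ip) (bigD1 i)//= (dotZl ip) orth_q// eqxx mulr1.
    rewrite big1 ?addr0// => j ji.
    by rewrite (dotZl ip) orth_q// (_ : (j == i :> nat) = false) ?mulr0//; exact/negbTE.
  have qi : `|q`_i| = 1 by rewrite (dot1_norm ip)// orth_q ?eqxx.
  have := dot_le ip (f v) q`_i; have := dot_ge ip (f v) q`_i.
  by rewrite qi mulr1 ler_norml => -> ->.
have cd : continuous (fun v => `|z - f v|).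
  move=> v; apply: (@continuous_comp _ _ _ (fun v => z - f v) Num.norm).
    by apply: continuousB; [exact: cst_continuous | exact: cf].
  exact: norm_continuous.
pose K := [set v | C (f v)] `&` [set v | `|z - f v| <= `|z - p0|].
have closedK : closed K.
  apply: closedI; first by move/continuous_closedP : cf; exact.
  by move/continuous_closedP : cd => /(_ _ (@closed_le R `|z - p0|)).
pose M := `|z| + `|z - p0|.
have compK : compact K.
  apply: (@subclosed_compact _ _ [set v : 'rV[R]_d | forall i, v 0 i \in `[- M, M]]) => //.
    by apply: (@rV_compact _ _ (fun=> `[- M, M]%classic)) => i; exact: segment_compact.
  move=> v [_ /= vz] i; rewrite in_itv/= -ler_norml (le_trans (fcoord v i))//.
  rewrite -[f v](subKr z) (le_trans (ler_normB _ _))// lerD2l//.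
have [v0 v0E] := fK p0.
have K0 : K !=set0 by exists v0; rewrite /K /= v0E.
have [v vK vmin] := compact_EVT_min K0 compK (continuous_subspaceT cd).
move: (vK); rewrite inE => -[/= Cv vz]; exists (f v); split=> // y Cy.
have [yz|/ltW yz] := leP `|z - y| `|z - p0|; last exact: le_trans yz.
by have [u uE] := fK y; rewrite -uE; apply: vmin; rewrite inE; split; rewrite /= uE.
Qed.

Lemma proj_onto_in (C : set X) z : closed C -> C !=set0 -> C (proj_onto C z).
Proof.
move=> closedC C0; rewrite /proj_onto.
by case: xgetP => [p _ []//|]; have [p pP] := nearest_point_exists z closedC C0 => /(_ p).
Qed.

(** Moving from the projection toward [y] cannot come closer to [z], whence [0 <= dot a b];
    expanding the squared norm of [a + b] concludes. *)
Lemma proj_onto_dist (C : set X) z y :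
  closed C -> convex_set (C : set (convex_lmodType X)) -> C y ->
  `|proj_onto C z - y| <= `|z - y|.
Proof.
move=> closedC cC Cy; have C0 : C !=set0 by exists y.
have Cp := proj_onto_in z closedC C0.
have pmin u : C u -> `|z - proj_onto C z| <= `|z - u|.
  move: u; rewrite /proj_onto; case: xgetP => [p _ []//|].
  by have [p pP] := nearest_point_exists z closedC C0 => /(_ p).
move: (proj_onto C z) Cp pmin => p Cp pmin.
have [a aE] : exists a, a = z - p by exists (z - p).
have [b bE] : exists b, b = p - y by exists (p - y).
rewrite -aE in pmin *; rewrite -bE.
have ab0 : 0 <= dot a b.
  rewrite leNgt; apply/negP => ab.
  have b0 : 0 < dot b b.
    rewrite lt_neqAle (dot_ge0 ip) andbT; apply/eqP => bb.
    have bz : b = 0 by apply/eqP; rewrite -normr_eq0 -sqrf_eq0 (sqr_norm ip) -bb.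
    by move: ab; rewrite bz (dotC ip) (dot0l ip) ltxx.
  (* Small enough that the quadratic cost [t ^+ 2 * dot b b] is at most half of the linear gain
     [- 2 * t * dot a b]. *)
  pose t := Num.min 1 (- dot a b / dot b b).
  have t0 : 0 < t by rewrite lt_min ltr01 divr_gt0 ?oppr_gt0.
  have t1 : t <= 1 by rewrite ge_min lexx.
  have tb : t * dot b b <= - dot a b by rewrite -ler_pdivlMr// ge_min lexx orbT.
  have := pmin _ (convex_set_segment cC Cp Cy (ltW t0) t1).
  have -> : z - (p + t *: (y - p)) = a + t *: b.
    by rewrite aE bE opprD addrA -scalerN opprB.
  rewrite -ler_sqr ?nnegrE// !(sqr_norm ip) !(dotE ip) (dotC ip b a) leNgt => /negP; apply.
  have : t * (t * dot b b) <= t * - dot a b by rewrite ler_wpM2l// ltW.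
  have : t * dot a b < 0 by rewrite pmulr_rlt0.
  lra.
rewrite -ler_sqr ?nnegrE// (_ : z - y = a + b); last by rewrite aE bE addrA subrK.
rewrite !(sqr_norm ip) !(dotE ip) (dotC ip b a).
have := dot_ge0 ip a; lra.
Qed.

End ConvexGeometry.

(** * Level sets and regularity *)

Section LevelSets.
Context {R : realType} {X : normedModType R} (dot : X -> X -> R).
Context (ip : inner_product dot) (pref : rel X) (C : set X).
Context (pref_total : total pref) (pref_trans : transitive pref).
Context (pref_plateau_free : plateau_free pref C).
Implicit Types (x y a n u : X) (r t h : R).

Let pref_refl x : pref x x.
Proof. by have := pref_total x x; rewrite orbb. Qed.

Let level_refl x : level pref x x.
Proof. by rewrite /level /= /indifferent pref_refl. Qed.

Lemma level_set_gap_le x a y :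
  optima pref C a -> level pref x y -> level_set_gap pref C x <= `|a - y|.
Proof. exact: set_dist_le. Qed.

Lemma level_set_gap_ge0 x : optima pref C !=set0 -> 0 <= level_set_gap pref C x.
Proof. by move=> opt0; apply: set_dist_ge => //; exists x; exact: level_refl. Qed.

Lemma level_set_gap_optima x : optima pref C x -> level_set_gap pref C x <= 0.
Proof. by move=> opt_x; rewrite -(normr0 X) -(subrr x) level_set_gap_le. Qed.

(** The segment from [a], which lies in the sublevel set, to [y] meets the boundary, and
    plateau-freeness makes this a point of the level set. *)
Lemma level_set_gap_segment x a y :
  C x -> ~ optima pref C x -> optima pref C a -> ~ interior (sublevel pref x) y ->
  level_set_gap pref C x <= `|a - y|.
Proof.
move=> Cx nopt_x opt_a ny; have ax : sublevel pref x a by case: opt_a => _; exact.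
have [t /andP[t0 t1]] := segment_boundary ax ny.
rewrite pref_plateau_free// => /(level_set_gap_le opt_a) /le_trans; apply.
by rewrite opprD addrA subrr sub0r normrN normrZ ger0_norm// distrC ler_piMl.
Qed.

(** A point indifferent to [y] is either indifferent to [x] or outside the sublevel set of [x]; in
    the second case the segment to it from an optimum crosses the level set of [x]. *)
Lemma le_level_set_gap x y : optima pref C !=set0 -> C x -> pref x y ->
  level_set_gap pref C x <= level_set_gap pref C y.
Proof.
move=> opt0 Cx xy; have [opt_x|nopt_x] := pselect (optima pref C x).
  exact: le_trans (level_set_gap_optima opt_x) (level_set_gap_ge0 _ opt0).
apply: set_dist_ge => //; first by exists y; exact: level_refl.
move=> a z opt_a /andP[zy yz]; have xz := pref_trans xy yz.
have [zx|zx] := boolP (pref z x).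
  by apply: level_set_gap_le => //; rewrite /level /= /indifferent zx.
apply: level_set_gap_segment => // /interior_subset zx'.
by move/negP : zx; exact.
Qed.

Lemma level_set_gap_le_dot x n a :
  C x -> ~ optima pref C x -> optima pref C a -> `|n| = 1 ->
  (forall y, pref y x -> dot n (y - x) <= 0) ->
  level_set_gap pref C x <= dot n (x - a).
Proof.
move=> Cx nopt_x opt_a n1 half.
have c0 : 0 <= dot n (x - a).
  have /half : pref a x by case: opt_a => _; exact.
  by rewrite -(opprB x a) (dotNr ip) oppr_le0.
set c := dot n (x - a) in c0 *.
have -> : c = `|a - (a + c *: n)|.
  by rewrite opprD addrA subrr sub0r normrN normrZ n1 mulr1 ger0_norm.
apply: level_set_gap_segment => // /interior_normP[e e0 eS].
(* Were the point interior, a further move along [n] would leave the half-space while staying in the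
   sublevel set. *)
have : sublevel pref x (a + c *: n + (e / 2) *: n).
  apply: eS; rewrite opprD addrA subrr sub0r normrN normrZ n1 mulr1.
  by rewrite gtr0_norm ?divr_gt0// ltr_pdivrMr// ltr_pMr// ltr1n.
move=> /half; have -> : a + c *: n + (e / 2) *: n - x =
    - (x - a) + (c *: n + (e / 2) *: n) by rewrite opprB -(addrA a) addrAC.
rewrite (dotDr ip) (dotNr ip) -/c (dotDr ip) !(dotZr ip) (norm1_dot ip n1).
by rewrite !mulr1 addKr leNgt divr_gt0.
Qed.

Context (pref_convex : convex_pref pref).

(** The step [h *: u] enters the open inner ball of radius [r] exactly when [h < - 2 * r * dot n u];
    the half-space settles the directions with [0 < dot n u]. *)
Lemma regular_comparisons x h r :
  C x -> ~ optima pref C x -> (exists r', regular_at pref r' x) ->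
  0 < h -> 0 < r -> (r%:E <= regularity_radius pref x)%E ->
  exists n, [/\ `|n| = 1,
    forall y, pref y x -> dot n (y - x) <= 0,
    forall u, dot u u = 1 -> 0 < dot n u -> ~~ pref (x + h *: u) x &
    forall u, dot u u = 1 -> dot n u < - (h / (2 * r)) -> ~~ pref x (x + h *: u)].
Proof.
move=> Cx nopt_x [r1 [bdx r1_gt0 [n1 n1_1 n1_balls]]] h0 r0 r_le.
(* Regularity provides a witness, so [xget] does not return its default. *)
have [nn1 [r2 r2_gt0 [inner2 _]]] : `|normal_at pref x| = 1 /\
    exists2 r, 0 < r & tangent_balls pref x (normal_at pref x) r.
  rewrite /normal_at; case: xgetP => [n _ []//|/(_ n1)]; case; split=> //.
  by exists r1.
set n := normal_at pref x in nn1 inner2 *.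
have half y : pref y x -> dot n (y - x) <= 0.
  exact: (supporting_halfspace ip (@pref_convex x) bdx r2_gt0 nn1 inner2).
exists n; split=> // [u u1 nu|u u1 nu].
  apply/negP => /half; rewrite addrAC subrr add0r (dotZr ip).
  by rewrite leNgt mulr_gt0.
have hr : - dot n u * r > h / 2.
  by move: nu; rewrite ltrNr invfM mulrA ltr_pdivrMr.
have nu0 : 0 < - dot n u.
  have h2 : 0 < h / 2 by rewrite divr_gt0.
  by have := lt_trans h2 hr; rewrite pmulr_lgt0.
(* The radius is a supremum, possibly infinite; the strict inequality leaves room for an admissible
   [r3]. *)
have lt_r : ((h / 2 / - dot n u)%:E < regularity_radius pref x)%E.
  by apply: lt_le_trans r_le; rewrite lte_fin ltr_pdivrMr// [r * _]mulrC.
have [_ [r3 [r3_ge0 [inner3 _]] <-]] := ereal_sup_gt lt_r.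
rewrite lte_fin ltr_pdivrMr// -/n in inner3 * => hr3.
have ball3 : `|x - r3 *: n - (x + h *: u)| < r3.
  rewrite opprD addrACA subrr add0r -ltr_sqr ?nnegrE// (sqr_norm ip).
  rewrite !(dotE ip) (dotC ip u n) u1 (norm1_dot ip nn1).
  have : h * (h / 2) < h * (r3 * - dot n u) by rewrite ltr_pM2l.
  lra.
have intx : interior (sublevel pref x) (x + h *: u).
  apply/interior_normP; exists (r3 - `|x - r3 *: n - (x + h *: u)|).
    by rewrite subr_gt0.
  move=> y xy; apply: inner3.
  change (`|x - r3 *: n - y| <= r3).
  have -> : x - r3 *: n - y = (x - r3 *: n - (x + h *: u)) + (x + h *: u - y).
    by rewrite addrA subrK.
  by apply: (le_trans (ler_normD _ _)); rewrite addrC -lerBrDr ltW.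
(* A tie would place this interior point on the boundary, by plateau-freeness. *)
apply/negP => xu; have : boundary (sublevel pref x) (x + h *: u).
  rewrite pref_plateau_free// /level /= /indifferent xu andbT.
  exact: (interior_subset intx).
by move=> [_]; exact.
Qed.

End LevelSets.

(** * Descent *)

Section Iterates.
Context {R : realType} {X : normedModType R} (dot : X -> X -> R) (pref : rel X).
Context (pref_total : total pref) (pref_trans : transitive pref).
Context (C : set X) (C_proj : forall z, C (proj_onto C z)).
Context (x1 : X) (C_x1 : C x1) (d : nat) (eta h : R) (T : nat).
Context (q : nat -> d.-tuple X) (th : nat -> nat -> R).

Let state k := (exec pref (ndd dot C x1 eta h T q th k)).1.

Lemma ndd_feasible k : C (state k).1 /\ C (state k).2.
Proof.
elim: k => [//|k [_ IH]]; rewrite /state exec_ndd_succ; cbv zeta.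
by split=> /=; [exact: C_proj | case: ifP => // _; exact: C_proj].
Qed.

Lemma ndd_best j k : (j <= k)%N -> pref (state k).2 (state j).1.
Proof.
have refl x : pref x x by have := pref_total x x; rewrite orbb.
elim: k => [|k IH]; first by rewrite leqn0 => /eqP ->; exact: refl.
set s := state k in IH; pose n := (exec pref (normal_estimate dot s.1 h T (q k) (th k))).1.
have sE : state k.+1 = (proj_onto C (s.1 - eta *: n),
    if ~~ pref s.2 (proj_onto C (s.1 - eta *: n)) then proj_onto C (s.1 - eta *: n)
    else s.2).
  by rewrite /state exec_ndd_succ; cbv zeta; rewrite [LHS]/= first_betterE.
rewrite leq_eqVlt => /predU1P[->|]; rewrite sE.
  by case: ifPn => [_|/negPn]; [exact: refl|].
rewrite ltnS => /IH sj /=; case: ifPn => [ps|//].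
apply: pref_trans sj; have := pref_total s.2 (proj_onto C (s.1 - eta *: n)).
by rewrite (negbTE ps).
Qed.

End Iterates.

(* [g] is the progress that the exact normal [n] would guarantee. *)
Lemma projected_step (R : realType) (X : normedModType R) (dot : X -> X -> R)
    (ip : inner_product dot) (C : set X) (x a n nh : X) (eta g delta : R) :
  (forall z, `|proj_onto C z - a| <= `|z - a|) -> 0 <= eta -> dot nh nh = 1 ->
  g <= dot n (x - a) -> `|nh - n| <= delta ->
  `|proj_onto C (x - eta *: nh) - a| ^+ 2
    <= `|x - a| ^+ 2 + eta ^+ 2 - 2 * eta * (g - delta * `|x - a|).
Proof.
move=> proj_a eta0 nh1 g_le nhn.
have le1 : `|proj_onto C (x - eta *: nh) - a| ^+ 2 <= `|x - eta *: nh - a| ^+ 2.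
  by rewrite ler_sqr ?nnegrE.
apply: (le_trans le1).
have [v vE] : exists v, v = x - a by exists (x - a).
rewrite addrAC -vE in g_le *.
have nhE : dot nh v = dot n v + dot (nh - n) v by rewrite -(dotDl ip) subrKC.
have le2 : - (delta * `|v|) <= dot (nh - n) v.
  by apply: le_trans (dot_ge ip _ _); rewrite lerN2 ler_wpM2r.
have le3 : eta * (g - delta * `|v|) <= eta * dot nh v.
  by rewrite ler_wpM2l// nhE lerD.
rewrite !(sqr_norm ip) !(dotE ip) (dotC ip v nh) nh1.
move: le3; set y := dot nh v; set w := delta * `|v|; lra.
Qed.

(** Meant for a possibly infinite diameter: [y] excludes [+oo] and the lower bound [x] excludes
    [-oo], so [fine] returns the true minimum. *)
Lemma le_fine_min (R : realType) (x y : R) (z : \bar R) :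
  x <= y -> (x%:E <= z)%E -> x <= fine (Order.min y%:E z).
Proof.
move=> xy; case: z => [z||] //; last by move=> _; rewrite minEle leey.
by rewrite lee_fin => xz; rewrite minEle; case: ifP => _ /=.
Qed.

(** [D1] is an infimum, so the descent uses an optimum at distance less than [D1 + f]; this controls
    the excess in the squared distance. *)
Lemma ler_sqr_perturb (R : realType) (D s : R) : 0 <= D -> 0 < s ->
  exists2 e, 0 < e & forall f, 0 < f -> f <= e -> (D + f) ^+ 2 < D ^+ 2 + s.
Proof.
move=> D0 s0; have D1 : 0 < 2 * D + 1 by rewrite ltr_wpDl// mulr_ge0.
exists (Num.min 1 (s / 2 / (2 * D + 1))).
  by rewrite lt_min ltr01 !divr_gt0.
move=> f f0; rewrite le_min ler_pdivlMr// => /andP[f1 fs].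
have -> : (D + f) ^+ 2 = D ^+ 2 + f * (2 * D + f) by ring.
rewrite ltrD2l; have : f * (2 * D + f) <= f * (2 * D + 1) by rewrite ler_pM2l// lerD2l.
lra.
Qed.

Theorem theorem4p4 (R : realType) (X : normedModType R)
  (dot : {dot X for idfun}) (d : nat)
  (pref : rel X) (C : set X) (x1 : X) (h : R) (T K : nat)
  (disp : measure_display) (Omega : measurableType disp)
  (P : probability Omega R)
  (q : nat -> Omega -> d.-tuple X) (th : nat -> nat -> {RV P >-> R})
  (norm_dot : forall x : X, `|x| = Num.sqrt (dot x x))
  (dimX : Vector.axiom d X)
  (d_ge2 : (2 <= d)%N)
  (pref_total : total pref)
  (pref_trans : transitive pref)
  (C_nonempty : C !=set0)
  (C_closed : closed C)
  (C_convex : convex_set (C : set (convex_lmodType X)))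
  (opt_nonempty : optima pref C !=set0)
  (pref_convex : convex_pref pref)
  (pref_plateau_free : plateau_free pref C)
  (pref_regular : forall x, C x -> ~ optima pref C x ->
     exists r, regular_at pref r x)
  (C_x1 : C x1)
  (x1_nonopt : ~ optima pref C x1)
  (K_ge1 : (1 <= K)%N)
  (h_gt0 : 0 < h)
  (T_ge1 : (1 <= T)%N)
  (draws : ndd_draws dot K q th) :
  let D1 := set_dist [set x1] (optima pref C) in
  let eta := D1 / Num.sqrt K%:R in
  let Dt := fine (Order.min (D1 + eta / 2 * (K - 1)%:R)%:E (diam C)) in
  let eps := 2 * D1 / Num.sqrt K%:R
             + pi * Num.sqrt (d - 1)%:R * Dt / 2 ^+ (T - 1) in
  forall w : Omega,
  let run k := exec pref
    (ndd dot C x1 eta h T (fun j => q j w) (fun j i => th j i w) k) in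
  let x_ k := (run k.-1).1.1 in
  let xhat := (run K).1.2 in
  let comparisons := (run K).2 in
  (comparisons <= K * ((d - 1) * (T + 3) + 2))%N /\
  (level_set_gap pref C xhat <= eps \/
   exists k, [/\ (1 <= k <= K)%N,
     ~ optima pref C (x_ k),
     (regularity_radius pref (x_ k) <
       (4 * Num.sqrt (d - 1)%:R * Dt * h / eps)%:E)%E &
     pref xhat (x_ k)]).
Proof.
move=> D1 eta Dt eps w run x_ xhat comparisons.
split; first exact: ndd_count.
have ip := inner_product_dot norm_dot.
have orth_q k : (k < K)%N -> orthonormal_family dot (q k w).
  by move=> kK; have [] := draws_basis draws kK.
have C_proj z : C (proj_onto C z).
  exact: (proj_onto_in ip dimX (orth_q 0%N K_ge1)).
have proj_le a z : C a -> `|proj_onto C z - a| <= `|z - a|.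
  exact: (proj_onto_dist ip dimX (orth_q 0%N K_ge1)).
set qw := fun j => q j w; set thw := fun j i => th j i w.
have feas k := ndd_feasible dot pref C_proj C_x1 eta h T qw thw k.
have best j k : (j <= k)%N -> pref (run k).1.2 (run j).1.1.
  exact: ndd_best.
have C_hat : C xhat by case: (feas K).
have hat_best k : (k <= K)%N -> pref xhat (run k).1.1 by exact: best.
have [|gap_gt] := leP (level_set_gap pref C xhat) eps; first by left.
right; apply: contrapT => no_k.
have gap_le x : pref xhat x -> level_set_gap pref C xhat <= level_set_gap pref C x.
  exact: le_level_set_gap.
have D1_le a : optima pref C a -> D1 <= `|x1 - a| by move=> ?; exact: set_dist_le.
have D1_ge0 : 0 <= D1 by apply: set_dist_ge => //; exists x1.
have gap_x1 : level_set_gap pref C x1 <= D1.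
  apply: set_dist_ge => //; first by exists x1.
  move=> _ a -> opt_a; rewrite distrC; apply: level_set_gap_le => //.
  by rewrite /level /= /indifferent; have := pref_total x1 x1; rewrite orbb => ->.
have sqrtK : 0 < Num.sqrt K%:R :> R by rewrite sqrtr_gt0 ltr0n.
have eta_ge0 : 0 <= eta by rewrite divr_ge0 ?sqrtr_ge0.
(* Both terms of the minimum dominate [D1], the diameter through the distance from [x1] to any
   optimum. *)
have Dt_ge : D1 <= Dt.
  apply: le_fine_min.
    by rewrite lerDl mulr_ge0 ?divr_ge0.
  have [a opt_a] := opt_nonempty; apply: le_trans (_ : `|x1 - a|%:E <= _)%E.
    by rewrite lee_fin D1_le.
  by apply: ereal_sup_ubound; exists x1 => //; exists a => //; case: opt_a.
set A := pi * Num.sqrt (d - 1)%:R * Dt / 2 ^+ (T - 1).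
have A_ge0 : 0 <= A.
  by rewrite divr_ge0 ?exprn_ge0// !mulr_ge0 ?pi_ge0 ?sqrtr_ge0// (le_trans D1_ge0).
have epsE : eps = 2 * eta + A by rewrite /eps -/A /eta mulrA.
(* If [D1] were 0, the gap of the output, at most that of [x1], could not exceed [eps]. *)
have D1_gt0 : 0 < D1.
  rewrite lt_neqAle D1_ge0 andbT; apply/eqP => D10.
  have := lt_le_trans gap_gt (le_trans (gap_le x1 (hat_best 0%N isT)) gap_x1).
  by rewrite ltNge epsE -D10 addr_ge0// mulr_ge0.
have eta_gt0 : 0 < eta by rewrite divr_gt0.
have eps_gt0 : 0 < eps by rewrite epsE ltr_wpDr// mulr_gt0.
have Dt_gt0 : 0 < Dt := lt_le_trans D1_gt0 Dt_ge.
set m := Num.sqrt (d - 1)%:R in A A_ge0 epsE.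
have m_gt0 : 0 < m by rewrite sqrtr_gt0 ltr0n subn_gt0.
pose r0 := 4 * m * Dt * h / eps.
have r0_gt0 : 0 < r0 by rewrite divr_gt0// !mulr_gt0.
(* An optimal iterate would make the output optimal, with gap at most 0. *)
have nopt k : (k <= K)%N -> ~ optima pref C (run k).1.1.
  move=> kK opt_k; have opt_hat : optima pref C xhat.
    by split=> // y Cy; apply: pref_trans (hat_best k kK) _; case: opt_k => _; exact.
  have := lt_trans eps_gt0 gap_gt; rewrite ltNge => /negP; apply.
  exact: level_set_gap_optima.
(* The state after [k] steps holds iterate number [k.+1], hence the witness against [no_k]. *)
have radius k : (k < K)%N -> (r0%:E <= regularity_radius pref (run k).1.1)%E.
  move=> kK; rewrite leNgt; apply/negP => lt_r; apply: no_k.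
  by exists k.+1; split=> //; [apply: nopt; exact: ltnW | apply: hat_best; exact: ltnW].
pose tau := h / (2 * r0).
pose delta := m * (pi / 2 ^+ T + 4 * tau).
have tau_ge0 : 0 <= tau by rewrite ltW// divr_gt0// mulr_gt0.
have delta_ge0 : 0 <= delta.
  apply: mulr_ge0; [exact: ltW | apply: addr_ge0; last exact: mulr_ge0].
  by rewrite divr_ge0 ?exprn_ge0 ?pi_ge0.
(* [r0] is such that [4 * m * tau * Dt = eps / 2]; the bisection error contributes [A / 2]. *)
have deltaE : delta * Dt = A / 2 + eps / 2.
  rewrite /delta /tau /r0 /A -[in 2 ^+ T](subnK T_ge1) addn1 exprS; field.
  by rewrite !gt_eqF ?exprn_gt0.
have step k a : (k < K)%N -> optima pref C a ->
    `|(run k.+1).1.1 - a| ^+ 2 <= `|(run k).1.1 - a| ^+ 2 + eta ^+ 2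
      - 2 * eta * (level_set_gap pref C (run k).1.1 - delta * `|(run k).1.1 - a|).
  move=> kK opt_a; rewrite {1}/run exec_ndd_succ; cbv zeta.
  set x := (run k).1.1; have Cx : C x by case: (feas k).
  have nopt_x : ~ optima pref C x by apply: nopt; exact: ltnW.
  have [n [n1 half above below]] := regular_comparisons ip pref_plateau_free
    pref_convex Cx nopt_x (pref_regular _ Cx nopt_x) h_gt0 r0_gt0 (radius k kK).
  have := normal_estimate_accuracy ip pref_total (norm1_dot ip n1) tau_ge0 above below
    T.-1 (thw k) dimX (orth_q k kK) d_ge2.
  rewrite prednK//.
  move=> [nh1 nh_n]; apply: (projected_step ip _ eta_ge0 nh1 _ nh_n).
    by move=> z; apply: proj_le; case: opt_a.
  by apply: level_set_gap_le_dot => //; case: feas.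
set s := level_set_gap pref C xhat - eps.
have s_gt0 : 0 < s by rewrite subr_gt0.
have K_gt0 : 0 < K%:R :> R by rewrite ltr0n.
have Keta : K%:R * eta ^+ 2 = D1 ^+ 2.
  by rewrite /eta expr_div_n sqr_sqrtr ?ler0n// mulrC divfK// gt_eqF.
have [e e_gt0 eP] := @ler_sqr_perturb R D1 (K%:R * (eta * s)) D1_ge0
  (mulr_gt0 K_gt0 (mulr_gt0 eta_gt0 s_gt0)).
(* Small enough to keep [(D1 + f) ^+ 2] below [D1 ^+ 2 + K * eta * s] and to cost at most half of
   the slack [s]. *)
pose f := Num.min e (s / 2 / (delta + 1)).
have delta1 : 0 < delta + 1 by rewrite ltr_wpDl.
have f_gt0 : 0 < f by rewrite lt_min e_gt0 !divr_gt0.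
have f_delta : delta * f <= s / 2.
  have : f * (delta + 1) <= s / 2 by rewrite -ler_pdivlMr// ge_min lexx orbT.
  by rewrite mulrDr mulr1 mulrC; apply: le_trans; rewrite lerDl ltW.
have [_ [a [-> opt_a x1a]]] :=
  set_dist_adherent (ex_intro [set x1] x1 erefl) opt_nonempty f_gt0.
have decr k : (k <= K)%N ->
    `|(run k).1.1 - a| ^+ 2 <= `|x1 - a| ^+ 2 - k%:R * (eta ^+ 2 + eta * s).
  elim: k => [|k IH] kK; first by rewrite mul0r subr0.
  apply: (le_trans (step k a kK opt_a)); have {}IH := IH (ltnW kK).
  set y := `|(run k).1.1 - a| in IH *.
  have y_ge0 : 0 <= y by exact: normr_ge0.
  (* By induction, the current distance to [a] is at most the initial one. *)
  have yD : y <= D1 + f.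
    apply: le_trans (ltW x1a); rewrite -ler_sqr ?nnegrE//; apply: (le_trans IH).
    rewrite lerBlDr lerDl mulr_ge0// addr_ge0 ?sqr_ge0// mulr_ge0 ?ltW//.
  have delta_y : delta * y <= A / 2 + eps / 2 + s / 2.
    rewrite -deltaE; apply: le_trans (_ : delta * (D1 + f) <= _).
      by rewrite ler_wpM2l.
    by rewrite mulrDr lerD// ler_wpM2l.
  have gap_k := gap_le _ (hat_best k (ltnW kK)).
  (* Since [eps = 2 * eta + A], a gap of at least [eps + s] minus an error of at most
     [(A + eps + s) / 2] leaves [eta + s / 2]. *)
  have : eta * (eta + s / 2) <= eta * (level_set_gap pref C (run k).1.1 - delta * y).
    rewrite ler_wpM2l//; move: gap_k delta_y epsE; rewrite /s; lra.
  move: IH; rewrite -(natr1 k); lra.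
(* The total decrease [D1 ^+ 2 + K * eta * s] exceeds the initial squared distance to [a], so the
   final one would be negative. *)
have := decr K (leqnn K); rewrite leNgt => /negP; apply.
apply: lt_le_trans (sqr_ge0 _); rewrite mulrDr Keta opprD addrA subr_lt0.
rewrite ltrBlDl; apply: lt_trans (eP f f_gt0 _).
  by rewrite ltr_sqr ?nnegrE// ltW// addr_gt0.
by rewrite ge_min lexx.
Qed.
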